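(* Given any $c_0\in\mathbb R\setminus\{-1\}$ and $a,b\in\mathbb R$ with $a<b$, there exists $u_0\in C_0^\infty(\mathbb R)\setminus\{0\}$ such that the corresponding solution $u=u(x,t)$ of $$\partial_t u+(1-\partial_x^2)^{-1}(\partial_x u+u\,\partial_x u)=0,\qquad u(x,0)=u_0(x),\quad x\in\mathbb R,$$ in $C([-T,T]:H^s(\mathbb R))$ with $s>1/2$ (or in $C^\infty((-T,T):C^{k,\theta}(\mathbb R))$) satisfies $$\text{(i)}\;\; u_0(x)=c_0\qquad\text{and}\qquad\text{(ii)}\;\;\partial_tu(x,0)=0,\qquad x\in(a,b).$$
   Context: $C_0^\infty(\mathbb R)$ denotes smooth compactly supported real functions. The nonlocal term is understood as $(1-\partial_x^2)^{-1}(\partial_xu+u\partial_xu)=\partial_x(1-\partial_x^2)^{-1}\big(u+\tfrac{u^2}{2}\big)$, where $\partial_x(1-\partial_x^2)^{-1}g=K*g$ with $K(x)=-\tfrac12\,\mathrm{sgn}(x)e^{-|x|}$. Well-posedness: for every $s\ge0$, $u_0\in H^s(\mathbb R)$ and $T>0$ there is a unique solution $u\in C([-T,T]:H^s(\mathbb R))$ (Bona-Tzvetkov). Also, for every integer $k\ge0$, $\theta\in[0,1]$ and $u_0\in C^{k,\theta}(\mathbb R)$ there exist $T>0$, depending on $\|u_0\|_{C^{k,\theta}}$, and a unique solution $u\in C^\infty((-T,T):C^{k,\theta}(\mathbb R))$. Here $C^{k,\theta}(\mathbb R)$ is the space of $C^k$ functions with bounded derivatives up to order $k$ and $\|f\|_{C^{k,\theta}}=\sum_{j=0}^k\|f^{(j)}\|_\infty+\sup_{h\ne0}\||h|^{-\theta}(f^{(k)}(\cdot+h)-f^{(k)}(\cdot))\|_\infty<\infty$.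 *)

(* Defs.v *)
From HB Require Import structures.
From mathcomp Require Import all_boot all_order all_algebra.
From mathcomp Require Import all_classical all_reals all_analysis.

Set Implicit Arguments.
Unset Strict Implicit.
Unset Printing Implicit Defensive.

Import Order.TTheory GRing.Theory Num.Theory numFieldNormedType.Exports.

Local Open Scope classical_set_scope.
Local Open Scope ring_scope.

Section BBM.
Variable R : realType.

Local Notation mu := (@lebesgue_measure R).

Definition Cc_infty (f : R -> R) : Prop :=
  (forall (n : nat) (x : R), derivable (derive1n n f) x 1) /\
  compact (closure [set x | f x != 0]).

(* The kernel K of d_x (1 - d_x^2)^-1. *)
Definition bbm_kernel (x : R) : R := - 2^-1 * Num.sg x * expR (- `|x|).

(* d_x (1 - d_x^2)^-1 (v + v^2/2) = K * (v + v^2/2), evaluated at x. *)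
Definition bbm_nonlocal (v : R -> R) (x : R) : R :=
  Rintegral mu setT (fun y => bbm_kernel (x - y) * (v y + v y ^+ 2 / 2)).

(* A function u of space and time is curried as u t x.  The equation is
   required at every point: the time derivative of u exists and equals
   - K * (u + u^2/2).  In the solution classes below the nonlocal term is
   continuous in t, so this agrees with the vector-valued and the integral
   forms of the equation. *)
Definition solves_BBM (T : R) (u0 : R -> R) (u : R -> R -> R) : Prop :=
  (forall x, u 0 x = u0 x) /\
  (forall t x, - T < t < T ->
    is_derive t (1 : R) (fun tau : R => u tau x) (- bbm_nonlocal (u t) x)).

(* The limit of F in L^2(R), unique up to a null set when it exists. *)
Definition L2_lim (F : nat -> R -> R) : R -> R :=
  xget (fun=> 0) [set g | g \in Lfun mu 2%:E /\
    ('N[mu]_2[EFin \o (g \- F n)%R])%E @[n --> \oo] --> 0%E].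

(* Real and imaginary parts of the Plancherel transform of f in L^2(R), with
   the convention  f^(xi) = lim_n \int_[-n, n] e^(- i x xi) f(x) dx. *)
Definition fourier_re (f : R -> R) : R -> R :=
  L2_lim (fun n xi => Rintegral mu `[- n%:R, n%:R]
    (fun x => f x * cos (x * xi))).
Definition fourier_im (f : R -> R) : R -> R :=
  L2_lim (fun n xi => Rintegral mu `[- n%:R, n%:R]
    (fun x => - (f x * sin (x * xi)))).

(* The L^2 norm of (1 + xi^2)^(s/2) |f^(xi)|. *)
Definition Hs_norm (s : R) (f : R -> R) : \bar R :=
  ('N[mu]_2[EFin \o (fun xi => (1 + xi ^+ 2) `^ (s / 2) *
     Num.sqrt (fourier_re f xi ^+ 2 + fourier_im f xi ^+ 2))%R])%E.

(* Meant for s >= 0, so that H^s(R) is a subspace of L^2(R). *)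
Definition in_Hs (s : R) (f : R -> R) : Prop :=
  f \in Lfun mu 2%:E /\ (Hs_norm s f < +oo)%E.

(* For s > 1/2 a class in H^s(R) has a unique continuous representative; each
   u t is taken to be that representative, so that point values make sense. *)
Definition in_C_Hs (s T : R) (u : R -> R -> R) : Prop :=
  (forall t, t \in `[- T, T] -> in_Hs s (u t) /\ continuous (u t)) /\
  (forall t0, t0 \in `[- T, T] ->
    Hs_norm s (u t \- u t0) @[t --> within `[- T, T] (nbhs t0)] --> 0%E).

Definition sup_norm (f : R -> R) : \bar R :=
  ereal_sup [set `|f x|%:E | x in setT].

Definition holder_seminorm (theta : R) (f : R -> R) : \bar R :=
  ereal_sup [set sup_norm (fun x => `|h| `^ (- theta) * (f (x + h) - f x))
            | h in [set h : R | h != 0]].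

Definition Ck_theta_norm (k : nat) (theta : R) (f : R -> R) : \bar R :=
  (\sum_(0 <= j < k.+1) sup_norm (derive1n j f) +
   holder_seminorm theta (derive1n k f))%E.

Definition in_Ck_theta (k : nat) (theta : R) (f : R -> R) : Prop :=
  [/\ forall (j : nat) (x : R), (j < k)%N -> derivable (derive1n j f) x 1,
      continuous (derive1n k f)
    & (Ck_theta_norm k theta f < +oo)%E].

(* U n is the n-th time derivative of u as a C^{k,theta}-valued map, i.e. a
   limit of difference quotients in the norm of C^{k,theta}. *)
Definition in_Cinfty_Ck_theta (k : nat) (theta T : R) (u : R -> R -> R) : Prop :=
  exists U : nat -> R -> R -> R,
    [/\ forall t, t \in `]- T, T[ -> U 0%N t = u t,
        forall n t, t \in `]- T, T[ -> in_Ck_theta k theta (U n t)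
      & forall n t, t \in `]- T, T[ ->
          Ck_theta_norm k theta
            (fun x => h^-1 * (U n (t + h) x - U n t x) - U n.+1 t x)
          @[h --> 0^'] --> 0%E].

Definition Hs_solution (s T : R) (u0 : R -> R) (u : R -> R -> R) : Prop :=
  in_C_Hs s T u /\ solves_BBM T u0 u.

Definition Ck_theta_solution (k : nat) (theta T : R) (u0 : R -> R)
    (u : R -> R -> R) : Prop :=
  in_Cinfty_Ck_theta k theta T u /\ solves_BBM T u0 u.

End BBM.

(* Main.v *)
Require Import Defs.
From HB Require Import structures.
From mathcomp Require Import all_boot all_order all_algebra.
From mathcomp Require Import all_classical all_reals all_analysis.
From mathcomp Require Import ring lra.

Import Order.TTheory GRing.Theory Num.Theory numFieldNormedType.Exports.

Local Open Scope classical_set_scope.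
Local Open Scope ring_scope.

(* At t = 0 the equation reads d_t u = - K * g with g = u0 + u0^2/2, so only u0
   matters.  If u0 = c0 on (a,b), write g0 = c0 + c0^2/2 and split the
   convolution at x in (a,b): the two halves are
   (e^x/2) \int_(y > x) e^(-y) g(y) dy and -(e^(-x)/2) \int_(y < x) e^y g(y) dy.
   They equal g0/2 and - g0/2 for every x in (a,b) as soon as the weighted mean
   of g over (b,+oo) with weight e^(b-y), and symmetrically over (-oo,a), is g0.
   With w = 1 + u0 one has 2 g + 1 = w^2, so the condition is that w^2 has
   weighted mean w(b)^2, which is positive because c0 <> -1.  A profile that
   drops to w = 0 right after b and returns to w = 1 far away has too small a
   mean; adding l times a bump makes the mean quadratic in l, and the quadratic
   takes the required value for some l <> 0. *)

(** * Smooth functions generated by the flat exponential *)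

Section SmoothClass.
Context {R : realType}.
Implicit Types (f g : R -> R) (x : R).

Definition flat (n : nat) (x : R) : R :=
  if 0 < x then x ^- n * expR (- x^-1) else 0.

(* The inverse powers make the functions flat n, and hence the whole class,
   closed under differentiation. *)
Inductive smooth_class : (R -> R) -> Prop :=
| sc_cst c : smooth_class (fun=> c)
| sc_flat n : smooth_class (flat n)
| sc_add f g : smooth_class f -> smooth_class g ->
    smooth_class (fun x => f x + g x)
| sc_mul f g : smooth_class f -> smooth_class g ->
    smooth_class (fun x => f x * g x)
| sc_inv f : smooth_class f -> (forall x, f x != 0) ->
    smooth_class (fun x => (f x)^-1)
| sc_affine f c d : smooth_class f -> smooth_class (fun x => f (c * x + d)).

Lemma flat_ge0 n x : 0 <= flat n x.
Proof.
rewrite /flat; case: ifPn => // x0.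
by rewrite mulr_ge0 ?expR_ge0// invr_ge0 exprn_ge0// ltW.
Qed.

Lemma flat_gt0 n x : 0 < x -> 0 < flat n x.
Proof. by move=> x0; rewrite /flat x0 mulr_gt0 ?expR_gt0// invr_gt0 exprn_gt0. Qed.

Lemma flat_le0 n x : x <= 0 -> flat n x = 0.
Proof. by rewrite /flat leNgt; case: ifP. Qed.

(** The inequality [z <= expR z] at [z = x^-1 / n.+2%:R], raised to the power [n.+2], beats the
    factor [x ^- n] by two degrees. This quadratic decay is what differentiability at 0 rests on. *)
Lemma flat_le n x : flat n x <= n.+2%:R ^+ n.+2 * x ^+ 2.
Proof.
rewrite /flat; case: ifPn => [x0|_]; last by rewrite mulr_ge0 ?sqr_ge0 ?exprn_ge0.
have -> : expR (- x^-1) = (expR (x^-1 / n.+2%:R) ^+ n.+2)^-1.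
  by rewrite -expRM_natr divfK// expRN.
have z0 : 0 < x^-1 / n.+2%:R by rewrite divr_gt0// invr_gt0.
have h : (x^-1 / n.+2%:R) ^+ n.+2 <= expR (x^-1 / n.+2%:R) ^+ n.+2.
  rewrite lerXn2r ?nnegrE ?expR_ge0 ?(ltW z0)//.
  by apply: le_trans (expR_ge1Dx _); rewrite lerDr.
have e0 : 0 < expR (x^-1 / n.+2%:R) ^+ n.+2 by exact/exprn_gt0/expR_gt0.
have xn0 : 0 < x ^+ n by exact: exprn_gt0.
have k0 : 0 < n.+2%:R ^+ n.+2 :> R by exact: exprn_gt0.
rewrite -invfM -div1r ler_pdivrMr; last exact: mulr_gt0 xn0 e0.
rewrite mulrA; apply: le_trans (ler_wpM2l _ h); last first.
  exact: mulr_ge0 (mulr_ge0 (ltW k0) (sqr_ge0 x)) (ltW xn0).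
rewrite expr_div_n exprVn le_eqVlt; apply/orP; left; apply/eqP.
have x0' : x != 0 by rewrite gt_eqF.
rewrite -[in x ^+ n.+2]addn2 exprD.
move: (x ^+ n) (_ ^+ n.+2) xn0 k0 => y k y0 k0.
by field; rewrite x0' !gt_eqF.
Qed.

Lemma flat_is_derive n x :
  is_derive x 1 (flat n) (flat n.+2 x - n%:R * flat n.+1 x).
Proof.
have [x0|x0|->] := ltgtP x 0.
- rewrite !flat_le0 ?ltW// mulr0 subr0.
  apply: (@near_eq_is_derive _ _ _ (cst 0)).
  near=> y; rewrite flat_le0//= ltW//; near: y; exact: lt_nbhsl.
- have xn0 : x != 0 by rewrite gt_eqF.
  have xnn0 : x ^+ n != 0 by rewrite expf_neq0.
  have D1 : is_derive x 1 (fun y : R => y^-1) (- x ^- 2).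
    apply: is_derive_eq; first exact: is_deriveV xn0 _.
    by rewrite /GRing.scale/= mulr1.
  have D2 : is_derive x 1 (fun y : R => expR (- y^-1)) (expR (- x^-1) * x ^- 2).
    by apply: is_derive_eq; rewrite opprK.
  have D3 : is_derive x 1 (fun y : R => (y ^+ n)^-1)
      (- (x ^+ n) ^- 2 * (n%:R * x ^+ n.-1)).
    have Dn : is_derive x 1 (fun y : R => y ^+ n) (n%:R * x ^+ n.-1).
      have := is_deriveX n (is_derive_id x (1 : R)).
      by rewrite exprfctE /GRing.scale/= mulr1.
    exact: (@is_deriveV _ (fun y => y ^+ n) _ _ _ xnn0 Dn).
  have D4 := is_deriveM D3 D2.
  apply: is_derive_eq.
    apply: (near_eq_is_derive _ D4).
    by near=> y; rewrite /flat ifT//; near: y; exact: lt_nbhsr.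
  (* The power rule leaves the truncated predecessor [n.-1], so [n = 0] is computed separately. *)
  rewrite /flat x0 /GRing.scale/=; case: n xnn0 {D3 D4} => [|n] xnn0.
    by rewrite !mul0r mulr0 mulr0 addr0 subr0; field.
  rewrite /= !exprS in xnn0 *.
  have : x ^+ n != 0 by rewrite expf_neq0.
  by move: (x ^+ n) => y y0; field; rewrite y0 xn0.
- rewrite !flat_le0// mulr0 subr0.
  (* By [flat_le] the difference quotient at 0 is bounded by a constant times [|h|]. *)
  have H : (fun h : R => h^-1 *: (flat n (h *: (1 : R) + 0) - flat n 0)) @ 0^' --> (0 : R).
    apply/cvgrPdist_le => /= e e0.
    near=> h.
    rewrite (flat_le0 n 0)// subr0 addr0 sub0r normrN /GRing.scale/= mulr1 normrM normfV.
    have h0 : 0 < `|h| by rewrite normr_gt0; near: h; exact: nbhs_dnbhs_neq.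
    rewrite mulrC ler_pdivrMr// ger0_norm ?flat_ge0//.
    apply: le_trans (flat_le n h) _.
    rewrite -(real_normK (num_real h)) expr2 mulrA ler_pM2r// -ler_pdivlMl ?exprn_gt0//.
    near: h; apply: dnbhs0_le.
    by rewrite mulr_gt0// invr_gt0 exprn_gt0.
  apply: DeriveDef; first by apply/cvg_ex; exists 0.
  by rewrite /derive; apply/cvg_lim.
Unshelve. all: by end_near.
Qed.

(** Each constructor has a differentiation rule whose result is again assembled from constructors,
    so the step can be iterated to every order. *)
Lemma smooth_class_derive f : smooth_class f ->
  exists2 g, smooth_class g & forall x, is_derive x 1 f (g x).
Proof.
elim=> {f} [c|n|f g _ [f' sf' df] _ [g' sg' dg]|f g sf [f' sf' df] sg [g' sg' dg]
  |f sf [f' sf' df] f0|f c d _ [f' sf' df]].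
- by exists (fun=> 0) => [|x]; [exact: sc_cst|exact: is_derive_cst].
- exists (fun x => flat n.+2 x + (- n%:R) * flat n.+1 x) => [|x].
    by apply: sc_add; [|apply: sc_mul; [exact: sc_cst|]]; exact: sc_flat.
  by rewrite mulNr; exact: flat_is_derive.
- by exists (fun x => f' x + g' x) => [|x]; [exact: sc_add|exact: is_deriveD].
- exists (fun x => f x * g' x + g x * f' x) => [|x].
    by apply: sc_add; apply: sc_mul.
  exact: is_deriveM.
- exists (fun x => (- 1) * ((f x)^-1 * (f x)^-1) * f' x) => [|x].
    apply: sc_mul => //; apply: sc_mul; first exact: sc_cst.
    by apply: sc_mul; apply: sc_inv.
  by rewrite mulN1r -invfM; exact: is_deriveV.
- exists (fun x => f' (c * x + d) * c) => [|x].
    by apply: sc_mul; [exact: sc_affine|exact: sc_cst].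
  apply: (@is_derive1_comp _ f (fun x => c * x + d)).
  apply: is_derive_eq.
  by rewrite /GRing.scale/= mulr1 addr0.
Qed.

Lemma smooth_class_derive1n f n : smooth_class f -> smooth_class (derive1n n f).
Proof.
move=> sf; elim: n => [//|n /smooth_class_derive[g sg dg]].
rewrite derive1nS (_ : (_^`())%classic = g)//.
by apply/funext => x; rewrite derive1E; have [_ ->] := dg x.
Qed.

Lemma smooth_class_derivable f n x : smooth_class f ->
  derivable (derive1n n f) x 1.
Proof.
move=> /(smooth_class_derive1n f n)/smooth_class_derive[g _ dg].
by have [] := dg x.
Qed.

Lemma smooth_class_continuous f : smooth_class f -> continuous f.
Proof.
move=> sf x; apply: differentiable_continuous.
by apply/derivable1_diffP; exact: (smooth_class_derivable f 0 x sf).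
Qed.

End SmoothClass.

(** * Smooth step and cutoff functions *)

Section SmoothStep.
Context {R : realType}.
Implicit Types (r x y : R).

Definition smooth_step x : R := flat 0 x * (flat 0 x + flat 0 (1 - x))^-1.

(** The numbers [x] and [1 - x] are never both nonpositive, so one of the two terms is positive. *)
Lemma smooth_step_den_gt0 x : 0 < flat 0 x + flat 0 (1 - x).
Proof.
have [x0|x0] := ltP 0 x; first by rewrite ltr_pwDl ?flat_gt0 ?flat_ge0.
by rewrite ltr_wpDl ?flat_ge0// flat_gt0// subr_gt0 (le_lt_trans x0).
Qed.

Lemma smooth_step_smooth : smooth_class smooth_step.
Proof.
apply: sc_mul; first exact: sc_flat.
apply: sc_inv => [|x]; last by rewrite gt_eqF// smooth_step_den_gt0.
apply: sc_add; first exact: sc_flat.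
rewrite (_ : (fun x : R => flat 0 (1 - x)) = fun x => flat 0 (- 1 * x + 1)).
  exact/sc_affine/sc_flat.
by apply/funext => x; rewrite mulN1r addrC.
Qed.

Lemma smooth_step_le0 x : x <= 0 -> smooth_step x = 0.
Proof. by move=> x0; rewrite /smooth_step flat_le0// mul0r. Qed.

Lemma smooth_step_ge1 x : 1 <= x -> smooth_step x = 1.
Proof.
move=> x1; rewrite /smooth_step (flat_le0 _ (1 - x)) ?subr_le0// addr0.
by rewrite divff// gt_eqF// flat_gt0// (lt_le_trans ltr01).
Qed.

Lemma smooth_step_itv x : 0 <= smooth_step x <= 1.
Proof.
have d0 := smooth_step_den_gt0 x; rewrite /smooth_step.
rewrite mulr_ge0 ?flat_ge0 ?invr_ge0 ?(ltW d0)//=.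
by rewrite ler_pdivrMr// mul1r lerDl flat_ge0.
Qed.

(** A descent from 1 to 0 on [[r, r + 1]]; the argument is spelled so as to match [sc_affine]. *)
Definition cutoff r y : R := smooth_step (- 1 * y + (r + 1)).

Lemma cutoff_smooth r : smooth_class (cutoff r).
Proof. exact/sc_affine/smooth_step_smooth. Qed.

Lemma cutoff_le r y : y <= r -> cutoff r y = 1.
Proof. by move=> yr; apply: smooth_step_ge1; lra. Qed.

Lemma cutoff_ge r y : r + 1 <= y -> cutoff r y = 0.
Proof. by move=> yr; apply: smooth_step_le0; lra. Qed.

Lemma cutoff_itv r y : 0 <= cutoff r y <= 1.
Proof. exact: smooth_step_itv. Qed.

End SmoothStep.

(** * Integrals over segments, and a quadratic equation *)

Section IntervalIntegral.
Context {R : realType}.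
Local Notation mu := (@lebesgue_measure R).
Implicit Types (f g : R -> R) (p q r k x y : R).

Lemma continuous_integrable_itv f p q : continuous f ->
  mu.-integrable `[p, q] (EFin \o f).
Proof.
move=> cf; apply: continuous_compact_integrable; first exact: segment_compact.
exact: continuous_subspaceT.
Qed.

Lemma Rintegral_itv_cat f p q r : continuous f -> p <= q -> q <= r ->
  \int[mu]_(y in `[p, r]) f y =
  \int[mu]_(y in `[p, q]) f y + \int[mu]_(y in `[q, r]) f y.
Proof.
move=> cf pq qr.
have cfi s t := continuous_integrable_itv f s t cf.
rewrite -[X in _ + X](@Rintegral_itv_obnd_cbnd _ q (BRight r)); last first.
  by apply: integrableS (cfi q r) => //; exact: subset_itv_oc_cc.
by rewrite -(@Rintegral_itvB _ f (BLeft p) (BRight r) q)// addrC subrK.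
Qed.

Lemma eq_Rintegral_itv g f p q : (forall y, p <= y <= q -> f y = g y) ->
  \int[mu]_(y in `[p, q]) f y = \int[mu]_(y in `[p, q]) g y.
Proof.
by move=> fg; apply: eq_Rintegral => y; rewrite inE/= in_itv/=; exact: fg.
Qed.

Lemma le_Rintegral_itv f g p q : continuous f -> continuous g ->
  (forall y, p <= y <= q -> f y <= g y) ->
  \int[mu]_(y in `[p, q]) f y <= \int[mu]_(y in `[p, q]) g y.
Proof.
move=> cf cg fg; by apply: le_Rintegral => //; exact: continuous_integrable_itv.
Qed.

Lemma Rintegral_itv_lin f g k p q : continuous f -> continuous g ->
  \int[mu]_(y in `[p, q]) (f y + k * g y) =
  \int[mu]_(y in `[p, q]) f y + k * \int[mu]_(y in `[p, q]) g y.
Proof.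
move=> cf cg; have ckg : continuous (fun y => k * g y).
  by move=> y; apply: cvgM; [exact: cvg_cst|exact: cg].
rewrite RintegralD//; try exact: continuous_integrable_itv.
by rewrite RintegralZl//; exact: continuous_integrable_itv.
Qed.

Lemma continuous_expRN : continuous (fun y : R => expR (- y)).
Proof.
move=> y; apply: (@continuous_comp _ _ _ -%R expR); first exact: opp_continuous.
exact: continuous_expR.
Qed.

Lemma Rintegral_itv_expRN p q : p <= q ->
  \int[mu]_(y in `[p, q]) expR (- y) = expR (- p) - expR (- q).
Proof.
rewrite le_eqVlt => /predU1P[->|pq].
  by rewrite set_itv1 Rintegral_set1 subrr.
have D x : is_derive x 1 (fun y : R => - expR (- y)) (expR (- x)).
  by apply: is_derive_eq; rewrite mulrN1 opprK.
have cF : continuous (fun y : R => - expR (- y)).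
  by move=> y; apply: cvgN; exact: continuous_expRN.
rewrite /Rintegral (@continuous_FTC2 _ _ (fun y => - expR (- y)))//=.
- by rewrite opprK addrC.
- by apply: continuous_subspaceT; exact: continuous_expRN.
- split => [x _||]; first by have [] := D x.
  + by apply: cvg_at_right_filter; exact: cF.
  + by apply: cvg_at_left_filter; exact: cF.
- by move=> x _; rewrite derive1E; have [_ ->] := D x.
Qed.

(** The quadratic starts below [K] at 0 and opens upwards, so the discriminant [s ^+ 2] exceeds
    [B ^+ 2] and the root [(s - B) / (2 * C)] cannot be 0. *)
Lemma quadratic_root (A B C K : R) : A < K -> 0 < C ->
  exists2 x, x != 0 & A + x * B + x ^+ 2 * C = K.
Proof.
move=> AK C0; pose s := Num.sqrt (B ^+ 2 + 4 * C * (K - A)).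
have s2 : s ^+ 2 = B ^+ 2 + 4 * C * (K - A).
  by rewrite sqr_sqrtr// addr_ge0 ?sqr_ge0// !mulr_ge0 ?subr_ge0 ?ltW.
have Cn0 : C != 0 by rewrite gt_eqF.
exists ((s - B) / (2 * C)).
  rewrite mulf_neq0 ?invr_eq0 ?mulf_neq0// subr_eq0; apply/eqP => sB.
  have : 0 < C * (K - A) by rewrite mulr_gt0// subr_gt0.
  by move: s2; rewrite sB; lra.
have -> : A + (s - B) / (2 * C) * B + ((s - B) / (2 * C)) ^+ 2 * C =
    A + (s ^+ 2 - B ^+ 2) / (4 * C) by field.
by rewrite s2; field.
Qed.

End IntervalIntegral.

(** * A profile with prescribed exponentially weighted mean *)

Section OneSidedProfile.
Context {R : realType}.
Local Notation mu := (@lebesgue_measure R).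

(** The right-hand side is the weighted integral of the constant flux of [c] over the whole
    half-line from [x]: seen from the left of [b], the profile is indistinguishable from that
    constant. The nonzero value beyond [b] keeps the datum nontrivial when [c = 0]. *)
Lemma one_sided_profile (c b : R) : c != -1 -> exists v : R -> R, exists L : R,
  [/\ smooth_class v, b < L,
      (forall y, y <= b -> v y = c) /\ (forall y, L <= y -> v y = 0),
      exists2 x, b < x & v x != 0
    & forall x, x <= b ->
      \int[mu]_(y in `[x, L]) (expR (- y) * (v y + v y ^+ 2 / 2)) =
      expR (- x) * (c + c ^+ 2 / 2)].
Proof.
move=> c1; pose w0 := 1 + c.
have w00 : 0 < w0 ^+ 2 by rewrite exprn_even_gt0//= /w0; apply: contra c1 => /eqP; lra.
(* The term [(w0 ^+ 2)^-1] makes the stretch where [w1] vanishes long enough for [eM], through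
   [1 + t <= expR t]. The [+ 2] leaves room for the rise of [w1] and then the fall of [phi], each of
   unit length. *)
pose M := b + 1 + (w0 ^+ 2)^-1; pose L := M + 2.
have bM : b + 1 < M by rewrite ltrDl invr_gt0.
have eM : expR (- M) < w0 ^+ 2 * expR (- (b + 1)).
  rewrite /M opprD expRD mulrC ltr_pM2r ?expR_gt0//.
  rewrite expRN -[ltRHS]invrK ltf_pV2 ?posrE ?expR_gt0 ?invr_gt0//.
  by apply: lt_le_trans (expR_ge1Dx _); rewrite ltrDr.
(* w1 falls from w0 to 0 on [b, b+1] and rises from 0 to 1 on [M, M+1]. *)
pose w1 y := 1 - cutoff M y + w0 * cutoff b y.
(* A bump equal to 1 on [[b + 1, M + 1]] and to 0 outside [[b, L]], so adding a multiple of it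
   alters neither the constant value before [b] nor the value 1 after [L]. *)
pose phi y := cutoff (M + 1) y - cutoff b y.
have sw1 : smooth_class w1.
  apply: sc_add; last by apply: sc_mul; [exact: sc_cst|exact: cutoff_smooth].
  rewrite (_ : (fun y => _) = fun y => 1 + (- 1) * cutoff M y); last first.
    by apply/funext => y; rewrite mulN1r.
  by apply: sc_add; [exact: sc_cst|apply: sc_mul; [exact: sc_cst|exact: cutoff_smooth]].
have sphi : smooth_class phi.
  rewrite /phi (_ : (fun y => _) = fun y => cutoff (M + 1) y + (- 1) * cutoff b y); last first.
    by apply/funext => y; rewrite mulN1r.
  apply: sc_add; first exact: cutoff_smooth.
  by apply: sc_mul; [exact: sc_cst|exact: cutoff_smooth].
have cmul (f g : R -> R) : continuous f -> continuous g ->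
    continuous (fun y => expR (- y) * (f y * g y)).
  by move=> cf cg y; apply: cvgM; [exact: continuous_expRN|apply: cvgM; [exact: cf|exact: cg]].
have cw1 := smooth_class_continuous _ sw1.
have cphi := smooth_class_continuous _ sphi.
pose A := \int[mu]_(y in `[b, L]) (expR (- y) * (w1 y * w1 y)).
pose B := \int[mu]_(y in `[b, L]) (expR (- y) * (w1 y * phi y)).
pose C := \int[mu]_(y in `[b, L]) (expR (- y) * (phi y * phi y)).
have cst_int (k p q : R) : p <= q ->
    \int[mu]_(y in `[p, q]) (k * expR (- y)) = k * (expR (- p) - expR (- q)).
  move=> pq; rewrite RintegralZl ?Rintegral_itv_expRN//.
  exact/continuous_integrable_itv/continuous_expRN.
have ccst k : continuous (fun y : R => k * expR (- y)).
  by move=> y; apply: cvgM; [exact: cvg_cst|exact: continuous_expRN].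
have split3 (f : R -> R) : continuous f -> \int[mu]_(y in `[b, L]) f y =
    \int[mu]_(y in `[b, b + 1]) f y + (\int[mu]_(y in `[b + 1, M]) f y +
    \int[mu]_(y in `[M, L]) f y).
  move=> cf; rewrite (@Rintegral_itv_cat _ f b (b + 1) L cf); [|lra|rewrite /L; lra].
  by rewrite (@Rintegral_itv_cat _ f (b + 1) M L cf)//; [lra|rewrite /L; lra].
(* The target is the mean condition on [[b, +oo)], namely [w0 ^+ 2 * expR (- b)], minus the tail
   [expR (- L)] contributed by [w = 1] beyond [L]. The three pieces of [A] are bounded with
   [w1 ^+ 2] at most [w0 ^+ 2], 0 and 1; [eM] makes the total strictly smaller. *)
have AK : A < w0 ^+ 2 * expR (- b) - expR (- L).
  rewrite /A split3; last exact: cmul.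
  have i1 : \int[mu]_(y in `[b, b + 1]) (expR (- y) * (w1 y * w1 y)) <=
      w0 ^+ 2 * (expR (- b) - expR (- (b + 1))).
    rewrite -cst_int; last lra.
    apply: le_Rintegral_itv => [||y /andP[by1 yb1]]; [exact: cmul|exact: ccst|].
    rewrite mulrC ler_pM2r ?expR_gt0// /w1 cutoff_le; last lra.
    rewrite subrr add0r -expr2 exprMn ger_pMr//.
    have /andP[h0 h1] := cutoff_itv b y.
    by rewrite expr_le1.
  have i2 : \int[mu]_(y in `[b + 1, M]) (expR (- y) * (w1 y * w1 y)) <= 0.
    have <- : 0 * (expR (- (b + 1)) - expR (- M)) = 0 by rewrite mul0r.
    rewrite -cst_int; last lra.
    apply: le_Rintegral_itv => [||y /andP[by1 yb1]]; [exact: cmul|exact: ccst|].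
    by rewrite /w1 cutoff_le// cutoff_ge// subrr mulr0 addr0 !mulr0 mul0r.
  have i3 : \int[mu]_(y in `[M, L]) (expR (- y) * (w1 y * w1 y)) <=
      1 * (expR (- M) - expR (- L)).
    rewrite -cst_int; last by rewrite /L; lra.
    apply: le_Rintegral_itv => [||y /andP[by1 yb1]]; [exact: cmul|exact: ccst|].
    rewrite mulrC ler_pM2r ?expR_gt0// /w1 (cutoff_ge b); last lra.
    have /andP[h0 h1] := cutoff_itv M y.
    by rewrite mulr0 addr0 -expr2 expr_le1//; lra.
  have := eM; lra.
(* The middle piece alone is positive, since [phi = 1] on [[b + 1, M]]. *)
have C0 : 0 < C.
  rewrite /C split3; last exact: cmul.
  have i0 p q : 0 <= \int[mu]_(y in `[p, q]) (expR (- y) * (phi y * phi y)).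
    by apply: Rintegral_ge0 => y _; rewrite mulr_ge0 ?expR_ge0// -expr2 sqr_ge0.
  have i2 : 1 * (expR (- (b + 1)) - expR (- M)) <=
      \int[mu]_(y in `[b + 1, M]) (expR (- y) * (phi y * phi y)).
    rewrite -cst_int; last lra.
    apply: le_Rintegral_itv => [||y /andP[by1 yb1]]; [exact: ccst|exact: cmul|].
    by rewrite /phi cutoff_le ?cutoff_ge//; lra.
  rewrite ltr_wpDl ?i0// ltr_pwDl ?i0//; apply: lt_le_trans i2.
  by rewrite mul1r subr_gt0 ltr_expR ltrN2.
(* The factor 2 is that of the cross term in the square of [w1 + l * phi]. *)
have [l l0 lE] := quadratic_root A (2 * B) C _ AK C0.
pose w y := w1 y + l * phi y.
have sw : smooth_class w.
  by apply: sc_add => //; apply: sc_mul => //; exact: sc_cst.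
have cw := smooth_class_continuous _ sw.
have Ew : \int[mu]_(y in `[b, L]) (expR (- y) * (w y * w y)) =
    w0 ^+ 2 * expR (- b) - expR (- L).
  rewrite -lE (eq_Rintegral_itv (fun y => expR (- y) * (w1 y * w1 y) +
     2 * l * (expR (- y) * (w1 y * phi y)) + l ^+ 2 * (expR (- y) * (phi y * phi y)))).
    rewrite Rintegral_itv_lin; [|move=> y|exact: cmul].
      by rewrite Rintegral_itv_lin; [rewrite -/A -/B -/C; ring|exact: cmul|exact: cmul].
    apply: cvgD; first exact: cmul.
    by apply: cvgM; [exact: cvg_cst|exact: cmul].
  by move=> y _; rewrite /w; ring.
have vb y : y <= b -> w y - 1 = c.
  by move=> yb; rewrite /w /w1 /phi !cutoff_le /w0; lra.
exists (fun y => w y - 1), L; split.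
- by apply: sc_add => //; exact: sc_cst.
- by rewrite /L; lra.
- by split=> // y Ly; rewrite /w /w1 /phi !cutoff_ge ?/L; rewrite /L in Ly; lra.
(* At this point [w1] and [phi] are both 1, so the profile takes the value [l]. *)
- exists (M + 1); first lra.
  by rewrite /w /w1 /phi (cutoff_le (M + 1))// !cutoff_ge//; [|lra..]; rewrite (_ : _ - 1 = l)//; lra.
- move=> x xb.
  have cg : continuous (fun y => expR (- y) * ((w y - 1) + (w y - 1) ^+ 2 / 2)).
    (* The flux of [w - 1] is [(w ^+ 2 - 1) / 2], so only the integral of [w ^+ 2] has to be
       known. *)
    have -> : (fun y => expR (- y) * ((w y - 1) + (w y - 1) ^+ 2 / 2)) =
        (fun y => 2^-1 * (expR (- y) * (w y * w y)) + (- 2^-1) * expR (- y)).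
      by apply/funext => y; field.
    move=> y; apply: cvgD; last exact: ccst.
    by apply: cvgM; [exact: cvg_cst|exact: cmul].
  (* The profile is constant on [[x, b]], and [Ew] evaluates the rest; the exponentials at [b] and
     at [L] then cancel. *)
  rewrite (@Rintegral_itv_cat _ _ x b L cg xb); last by rewrite /L; lra.
  rewrite [X in X + _](eq_Rintegral_itv (fun y => (c + c ^+ 2 / 2) * expR (- y))); last first.
    by move=> y /andP[_ yb]; rewrite vb// mulrC.
  rewrite cst_int//.
  rewrite [X in _ + X](eq_Rintegral_itv (fun y => (- 2^-1) * expR (- y) + 2^-1 * (expR (- y) * (w y * w y)))); last first.
    by move=> y _; field.
  rewrite Rintegral_itv_lin; [|exact: ccst|exact: cmul].
  rewrite cst_int; last by rewrite /L; lra.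
  by rewrite Ew /w0; field.
Qed.

End OneSidedProfile.

(** * The nonlocal term of a compactly supported function *)

Section Nonlocal.
Context {R : realType}.
Local Notation mu := (@lebesgue_measure R).

Lemma Rintegral_itv_opp (f : R -> R) (p q : R) : continuous f -> p <= q ->
  \int[mu]_(y in `[- q, - p]) f y = \int[mu]_(y in `[p, q]) f (- y).
Proof.
move=> cf pq; rewrite /Rintegral integration_by_substitution_oppr//.
exact: continuous_subspaceT.
Qed.

Lemma continuous_flux (f : R -> R) : continuous f ->
  continuous (fun y => f y + f y ^+ 2 / 2).
Proof.
move=> cf y; apply: cvgD; first exact: cf.
apply: cvgMl; apply: (@continuous_comp _ _ _ f (fun y => y ^+ 2)); first exact: cf.
exact: exprn_continuous.
Qed.

(* The kernel jumps at the diagonal, where it takes the value 0 (sg 0 = 0), so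
   the integrand is exactly the sum of its restrictions to the two open sides. *)
Lemma bbm_nonlocal_split (u : R -> R) (p q x : R) : continuous u ->
  p < x < q -> (forall y, y <= p -> u y = 0) -> (forall y, q <= y -> u y = 0) ->
  bbm_nonlocal u x =
    2^-1 * \int[mu]_(y in `[x, q]) (expR (x - y) * (u y + u y ^+ 2 / 2)) -
    2^-1 * \int[mu]_(y in `[p, x]) (expR (y - x) * (u y + u y ^+ 2 / 2)).
Proof.
move=> cu /andP[px xq] up uq.
pose g y := u y + u y ^+ 2 / 2.
have cg : continuous g by exact: continuous_flux.
pose f1 y := - 2^-1 * (expR (y - x) * g y).
pose f2 y := 2^-1 * (expR (x - y) * g y).
have cf1' : continuous (fun y => expR (y - x) * g y).
  move=> y; apply: cvgM; last exact: cg.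
  apply: (@continuous_comp _ _ _ (fun y => y - x) expR); last exact: continuous_expR.
  by apply: cvgB; [exact: cvg_id|exact: cvg_cst].
have cf2' : continuous (fun y => expR (x - y) * g y).
  move=> y; apply: cvgM; last exact: cg.
  apply: (@continuous_comp _ _ _ (fun y => x - y) expR); last exact: continuous_expR.
  by apply: cvgB; [exact: cvg_cst|exact: cvg_id].
have cf1 : continuous f1 by move=> y; apply: cvgMr; exact: cf1'.
have cf2 : continuous f2 by move=> y; apply: cvgMr; exact: cf2'.
have i1 : mu.-integrable `[p, x[ (EFin \o f1).
  apply: integrableS (continuous_integrable_itv f1 p x cf1) => //.
  exact: subset_itv_co_cc.
have i2 : mu.-integrable `]x, q] (EFin \o f2).
  apply: integrableS (continuous_integrable_itv f2 x q cf2) => //.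
  exact: subset_itv_oc_cc.
have g0 y : u y = 0 -> g y = 0 by move=> uy; rewrite /g uy expr0n/= mul0r addr0.
rewrite /bbm_nonlocal.
have -> : (fun y => bbm_kernel (x - y) * (u y + u y ^+ 2 / 2)) =
    (fun y => (f1 \_ `[p, x[) y + (f2 \_ `]x, q]) y).
  apply/funext => y; rewrite -/(g y) !patchE !mem_setE !in_itv/= /bbm_kernel.
  have [yx|xy|->] := ltgtP y x.
  - rewrite gtr0_sg ?subr_gt0// gtr0_norm ?subr_gt0// opprB andbT addr0 mulr1.
    case: leP => [_|yp]; first by rewrite /f1 mulrA.
    by rewrite g0 ?mulr0// up// ltW.
  - rewrite ltr0_sg ?subr_lt0// ltr0_norm ?subr_lt0// opprK andbF add0r mulrNN mulr1.
    case: leP => [_|yq]; first by rewrite /f2 mulrA.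
    by rewrite g0 ?mulr0// uq// ltW.
  - by rewrite subrr sgr0 mulr0 !mul0r andbF addr0.
rewrite RintegralD//; last 2 first.
- by rewrite -restrict_EFin; exact/(integrable_mkcond _ _).1.
- by rewrite -restrict_EFin; exact/(integrable_mkcond _ _).1.
rewrite -!Rintegral_mkcond Rintegral_itv_bndo_bndc// Rintegral_itv_obnd_cbnd//.
rewrite RintegralZl//; last exact: continuous_integrable_itv.
rewrite RintegralZl//; last exact: continuous_integrable_itv.
by rewrite mulNr addrC.
Qed.

End Nonlocal.

(** * Compact support, and gluing two profiles into the initial datum *)

Lemma smooth_class_Cc_infty {R : realType} (f : R -> R) (p q : R) :
  smooth_class f -> (forall y, y <= p -> f y = 0) ->
  (forall y, q <= y -> f y = 0) -> Cc_infty f.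
Proof.
move=> sf fp fq; split=> [n x|]; first exact: smooth_class_derivable.
apply: (subclosed_compact _ (@segment_compact R p q)); first exact: closed_closure.
rewrite (closure_id `[p, q]).1; last exact: itv_closed.
apply: closureS => y /= fy.
rewrite in_itv/= !leNgt; apply/andP; split; apply/negP => h; move: fy.
- by rewrite fp ?eqxx// ltW.
- by rewrite fq ?eqxx// ltW.
Qed.

Theorem theorem1p5 (R : realType) (c0 a b : R) :
  c0 != -1 -> a < b ->
  exists u0 : R -> R,
    [/\ Cc_infty u0,
        exists x, u0 x != 0,
        forall x, a < x < b -> u0 x = c0,
        forall (s T : R) (u : R -> R -> R), 2^-1 < s -> 0 < T ->
          Hs_solution s T u0 u ->
          forall x, a < x < b ->
            is_derive (0 : R) (1 : R) (fun t : R => u t x) 0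
      & forall (k : nat) (theta T : R) (u : R -> R -> R),
          0 <= theta <= 1 -> 0 < T ->
          Ck_theta_solution k theta T u0 u ->
          forall x, a < x < b ->
            is_derive (0 : R) (1 : R) (fun t : R => u t x) 0].
Proof.
move=> c01 ab.
have [v [q [sv bq [vb vq] [x1 bx1 vx1] Iv]]] := one_sided_profile c0 b c01.
have [w [p [sw ap [wa wp] _ Iw]]] := one_sided_profile c0 (- a) c01.
(* The profile [v] is [c0] up to [b], and the reflection of [w] is [c0] from [a] on; subtracting
   [c0] once glues them along their common constant stretch. *)
pose u0 y := v y + (w (- 1 * y + 0) + - c0).
have su0 : smooth_class u0.
  by apply: sc_add => //; apply: sc_add; [exact: sc_affine|exact: sc_cst].
have u0r y : a <= y -> u0 y = v y.
  by move=> ay; rewrite /u0 wa ?subrr ?addr0//; lra.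
have u0l y : y <= b -> u0 y = w (- y).
  by move=> yb; rewrite /u0 vb// mulN1r addr0 addrC subrK.
have u0p y : y <= - p -> u0 y = 0 by move=> yp; rewrite u0l ?wp//; lra.
have u0q y : q <= y -> u0 y = 0 by move=> qy; rewrite u0r ?vq//; lra.
have cv := smooth_class_continuous _ sv.
have cw := smooth_class_continuous _ sw.
have cG (f : R -> R) : continuous f ->
    continuous (fun y => expR (- y) * (f y + f y ^+ 2 / 2)).
  move=> cf y; apply: cvgM; first exact: continuous_expRN.
  exact: continuous_flux.
(* To the right of [x] only [v] is seen and to the left only the reflected [w]. Both halves equal
   [(c0 + c0 ^+ 2 / 2) / 2] and cancel. *)
have nonlocal0 x : a < x < b -> bbm_nonlocal u0 x = 0.
  move=> /andP[ax xb].
  rewrite (@bbm_nonlocal_split _ _ (- p) q)//; last 2 first.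
  - exact: smooth_class_continuous.
  - by apply/andP; split; lra.
  rewrite (eq_Rintegral_itv (fun y => expR x * (expR (- y) * (v y + v y ^+ 2 / 2)))); last first.
    by move=> y /andP[xy _]; rewrite u0r ?expRD ?mulrA//; lra.
  rewrite RintegralZl//; last exact/continuous_integrable_itv/cG.
  rewrite Iv ?ltW// mulrA -expRD subrr expR0 mul1r.
  rewrite (eq_Rintegral_itv (fun y => expR (- x) *
      (expR (- - y) * (w (- y) + w (- y) ^+ 2 / 2)))); last first.
    by move=> y /andP[_ yx]; rewrite u0l ?opprK ?expRD ?[expR y * _]mulrC ?mulrA//; lra.
  have cG' : continuous (fun y => expR (- - y) * (w (- y) + w (- y) ^+ 2 / 2)).
    move=> y; apply: (@continuous_comp _ _ _ -%R
      (fun z => expR (- z) * (w z + w z ^+ 2 / 2))); first exact: opp_continuous.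
    exact: cG.
  rewrite RintegralZl//; last exact: continuous_integrable_itv.
  (* Reflection carries [[- p, x]] to [[- x, p]], where [Iw] applies because [- x <= - a]. *)
  rewrite -[X in `[_, X]]opprK Rintegral_itv_opp//; last lra.
  rewrite (eq_Rintegral_itv (fun y => expR (- y) * (w y + w y ^+ 2 / 2))); last first.
    by move=> y _; rewrite !opprK.
  by rewrite Iw ?lerN2 ?ltW// mulrA -expRD opprK addNr expR0 mul1r subrr.
(* At time 0 the equation gives the derivative [- bbm_nonlocal u0 x], which [nonlocal0]
   evaluates. *)
have main T u : 0 < T -> solves_BBM T u0 u -> forall x, a < x < b ->
    is_derive (0 : R) (1 : R) (fun t : R => u t x) 0.
  move=> T0 [u00 du] x xab.
  have := du 0 x; rewrite oppr_lt0 T0 => /(_ isT).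
  have -> : u 0 = u0 by apply/funext.
  by rewrite nonlocal0// oppr0.
exists u0; split.
- exact: (@smooth_class_Cc_infty _ _ (- p) q).
- by exists x1; rewrite u0r//; lra.
- by move=> x /andP[ax xb]; rewrite u0r ?vb// ltW.
- by move=> s T u _ T0 [_ hu]; exact: (main T u).
- by move=> k theta T u _ T0 [_ hu]; exact: (main T u).
Qed.
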